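(* Let $n\ge 3$, let $K$ be a field and $S_n$ be as defined below. The algebra $K[S_n]$ is right primitive if and only if $K$ is countable; likewise, $K[S_n]$ is left primitive if and only if $K$ is countable.
   Context: For $n\ge 3$, $S_n$ denotes the monoid with generators $a_1,\dots,a_n$ and defining relations $a_1a_2\cdots a_n=a_{\sigma(1)}a_{\sigma(2)}\cdots a_{\sigma(n)}$ for all $\sigma$ in the cyclic subgroup of $\operatorname{Sym}_n$ generated by the cycle $(1,2,\dots,n)$. ''Countable'' includes finite. *)

(* Defs.v *)
From HB Require Import structures.
From mathcomp Require Import all_boot all_order all_algebra.
Set Implicit Arguments. Unset Strict Implicit. Unset Printing Implicit Defensive.
Import GRing.Theory.

(* Generators a_1,...,a_n of S_n are indexed by 'I_n (a_{i+1} <-> i).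
   Elements of the free monoid are words : seq 'I_n.
   The word a_1 a_2 ... a_n is [ord_enum n]; for sigma = (1 2 ... n)^k the word
   a_{sigma(1)} ... a_{sigma(n)} is [rot k (ord_enum n)].
   [Scong n] is the monoid congruence generated by the defining relations,
   so S_n = (seq 'I_n) / Scong n. *)
Inductive Scong (n : nat) : seq 'I_n -> seq 'I_n -> Prop :=
| Scong_rel (k : nat) (u v : seq 'I_n) :
    Scong (u ++ ord_enum n ++ v) (u ++ rot k (ord_enum n) ++ v)
| Scong_refl (w : seq 'I_n) : Scong w w
| Scong_sym (w1 w2 : seq 'I_n) : Scong w1 w2 -> Scong w2 w1
| Scong_trans (w1 w2 w3 : seq 'I_n) : Scong w1 w2 -> Scong w2 w3 -> Scong w1 w3.

Local Open Scope ring_scope.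

Section Reps.
Variables (K : fieldType) (V : lmodType K) (n : nat).
Variable T : 'I_n -> {linear V -> V}.

Definition ract (w : seq 'I_n) (v : V) : V := foldl (fun x i => T i x) v w.
Definition lact (w : seq 'I_n) (v : V) : V := foldr (fun i x => T i x) v w.

(* The action of words satisfies the defining relations of S_n, so that
   (V, T) is a (right resp. left) K[S_n]-module. *)
Definition Sn_rel (act : seq 'I_n -> V -> V) : Prop :=
  forall (k : nat) (v : V), act (ord_enum n) v = act (rot k (ord_enum n)) v.

Definition submod (U : V -> Prop) : Prop :=
  [/\ U 0, (forall x y, U x -> U y -> U (x + y)),
      (forall (a : K) x, U x -> U (a *: x)) &
      (forall i x, U x -> U (T i x))].

Definition simple_mod : Prop :=
  (exists v : V, v <> 0) /\
  forall U, submod U -> (forall v, U v -> v = 0) \/ (forall v, U v).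

(* Faithful: a nonzero element of K[S_n], i.e. a K-combination of pairwise
   distinct elements of S_n with not all coefficients 0, acts nontrivially. *)
Definition faithful_mod (act : seq 'I_n -> V -> V) : Prop :=
  forall (m : nat) (w : 'I_m -> seq 'I_n) (c : 'I_m -> K),
    (forall i j, Scong (w i) (w j) -> i = j) ->
    (forall v : V, \sum_(i < m) c i *: act (w i) v = 0) ->
    forall i, c i = 0.
End Reps.

Definition right_primitive_Sn (K : fieldType) (n : nat) : Prop :=
  exists (V : lmodType K) (T : 'I_n -> {linear V -> V}),
    [/\ Sn_rel (ract T), simple_mod T & faithful_mod (ract T)].

Definition left_primitive_Sn (K : fieldType) (n : nat) : Prop :=
  exists (V : lmodType K) (T : 'I_n -> {linear V -> V}),
    [/\ Sn_rel (lact T), simple_mod T & faithful_mod (lact T)].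

Definition countable_type (X : Type) : Prop :=
  exists f : X -> nat, injective f.

(* Main.v *)
Require Import Defs.
From HB Require Import structures.
From mathcomp Require Import all_boot all_order all_algebra generic_quotient.
From mathcomp Require Import boolp ring freeg.
Set Implicit Arguments. Unset Strict Implicit. Unset Printing Implicit Defensive.
Import GRing.Theory.
Local Open Scope ring_scope.

(* The word z = a_1 ... a_n is central in S_n, and S_n modulo z = 1 is a free group of
   rank n - 1, whose elements are the words without a factor a_c a_{c+1} ... a_{c-1}.

   If V is a faithful simple module, every nonzero polynomial in z acts bijectively on V,
   so for v0 <> 0 the vectors (z - l)^-1 v0, l in K, are linearly independent; as V is
   spanned by the countably many v0 w, the field K is countable.

   If K is countable, let F = K(t) and let V be the F-space on countably many copies of the
   free group, on which the letters act by right multiplication and z by t. Twist the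
   actions of a_1 and a_n by an involution E of V. All of V being countable, E can be built
   recursively so as to exchange u a_2^N with v a_2^-M a_1^-1 for all nonzero u and v, with N
   and M depending on (u, v) and chosen so that these vectors have pairwise disjoint
   supports. Then a_2^N a_1 a_2^M maps u to v, so V is simple over K[S_n]. It is faithful
   because E can be kept away from the paths traced by any finite list of words in some
   copy of the free group, where distinct words act independently over K. The left-handed
   statement follows by reversing words and the order of the letters. *)

(** * The congruence and the central word z *)

Lemma size_ord_enum n : size (ord_enum n) = n.
Proof. by rewrite -(size_map val) val_ord_enum size_iota. Qed.

Section Congruence.
Variable n : nat.
Local Notation e := (ord_enum n).
Implicit Types u v w : seq 'I_n.

Lemma Scong_cat u v w1 w2 : Scong w1 w2 -> Scong (u ++ w1 ++ v) (u ++ w2 ++ v).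
Proof.
elim=> [k u' v'|w|w w' _|w w' w'' _ IH1 _]; last exact: Scong_trans.
- have := Scong_rel k (u ++ u') (v' ++ v).
  by rewrite -!catA.
- exact: Scong_refl.
- exact: Scong_sym.
Qed.

Lemma Scong_catl u w1 w2 : Scong w1 w2 -> Scong (u ++ w1) (u ++ w2).
Proof. by move=> /(@Scong_cat u [::]); rewrite !cats0. Qed.

Lemma Scong_catr v w1 w2 : Scong w1 w2 -> Scong (w1 ++ v) (w2 ++ v).
Proof. exact: (@Scong_cat [::] v). Qed.

Lemma Scong_rot k : Scong e (rot k e).
Proof. by have := @Scong_rel n k [::] [::]; rewrite !cats0. Qed.

Lemma Scong_perm w1 w2 : Scong w1 w2 -> perm_eq w1 w2.
Proof.
elim=> // [k u v|w w' _|w w' w'' _ pw _]; last exact: perm_trans.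
- by rewrite perm_cat2l perm_cat2r perm_sym perm_rot.
- by rewrite perm_sym.
Qed.

Lemma nth_ord_enum_self (i : 'I_n) : nth i e i = i.
Proof.
by apply: val_inj; rewrite -(nth_map i 0%N) ?size_ord_enum // val_ord_enum nth_iota.
Qed.

Lemma rot_ord_enum (i : 'I_n) :
  exists s, rot i e = i :: s /\ rot i.+1 e = rcons s i.
Proof.
have lt_in : (i < size e)%N by rewrite size_ord_enum.
exists (drop i.+1 e ++ take i e); rewrite /rot (drop_nth i) // (take_nth i) //.
by rewrite nth_ord_enum_self rcons_cat.
Qed.

(** For each letter [i], one rotation of [e] is [i :: s] and the next is [rcons s i], so e i = i s i
    = i e in S_n. *)
Lemma Scong_cycle_central w : Scong (e ++ w) (w ++ e).
Proof.
elim: w => [|i w IH]; first by rewrite cats0; apply: Scong_refl.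
have [s [rot_i rot_i1]] := rot_ord_enum i.
apply: Scong_trans (Scong_catl [:: i] IH).
apply: Scong_trans (Scong_catr (i :: w) (Scong_rot i)) _; rewrite rot_i.
have := Scong_catr w (Scong_catl [:: i] (Scong_sym (Scong_rot i.+1))).
by rewrite rot_i1 /= -cats1 -catA.
Qed.

End Congruence.

(** * Normal forms of words modulo z = 1 *)

Section Stacks.
Variable m : nat.
Local Notation n := m.+3.
Local Notation e := (ord_enum n).
Implicit Types (c d : 'I_n) (s w : seq 'I_n).

(** Letters are added in Z/n, so that the rotations of [e] are exactly the words [rising c n]. *)
Definition rising c k : seq 'I_n := [seq c + j%:R | j <- iota 0 k].

Lemma risingSr c k : rising c k.+1 = rcons (rising c k) (c + k%:R).
Proof. by rewrite /rising -[k.+1]addn1 iotaD map_cat cats1. Qed.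

Lemma risingS c k : rising c k.+1 = c :: rising (c + 1) k.
Proof.
rewrite /rising /= addr0 (iotaDl 1 0) -map_comp; congr (_ :: _).
by apply: eq_map => j /=; rewrite natrD addrA.
Qed.

Lemma card_letters0 : n%:R = 0 :> 'I_n.
Proof. exact: (@pchar_Zp n). Qed.

Lemma natr_letter k : (k < n)%N -> val (k%:R : 'I_n) = k.
Proof. by move=> lt_kn; rewrite [LHS](@val_Zp_nat n) // modn_small. Qed.

Lemma rising0E : rising 0 n = e.
Proof.
apply: (inj_map val_inj); rewrite val_ord_enum -map_comp.
rewrite -[RHS]map_id; apply/eq_in_map => j; rewrite mem_iota add0n => lt_jn.
by apply: etrans (natr_letter lt_jn); congr (val _); apply: add0r.
Qed.

(* A stack lists a word from its last letter; [run] is the length of the longest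
   suffix of the word of the form c, c+1, c+2, ... *)
Fixpoint run s : nat :=
  if s is c :: s' then
    if s' is d :: _ then if c == d + 1 then (run s').+1 else 1
    else 1
  else 0.

Fixpoint irreducible s : bool :=
  if s is _ :: s' then (run s < n)%N && irreducible s' else true.

(** The reduction z = 1: the run that is tested includes [c] itself, so a completed factor of length
    n leaves n - 1 letters to remove from [s]. *)
Definition push s c : seq 'I_n :=
  if run (c :: s) == n then drop n.-1 s else c :: s.

Lemma run_cons_le c s : (run (c :: s) <= (run s).+1)%N.
Proof. by case: s => [|d s] //=; case: ifP. Qed.

Lemma irreducible_drop k s : irreducible s -> irreducible (drop k s).
Proof. by elim: s k => [|c s IH] [|k] //= /andP[_ /IH]. Qed.

Lemma irreducible_run s : irreducible s -> (run s < n)%N.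
Proof. by case: s => [|c s] // /andP[]. Qed.

Lemma push_irreducible s c : irreducible s -> irreducible (push s c).
Proof.
move=> irr_s; rewrite /push; case: eqP => [_|/eqP run_n]; first exact: irreducible_drop.
rewrite [irreducible _]/= irr_s andbT ltn_neqAle run_n.
exact: leq_trans (run_cons_le _ _) (irreducible_run irr_s).
Qed.

Lemma run_succ c s : run [:: c + 1, c & s] = (run (c :: s)).+1.
Proof. by rewrite {1}/run eqxx. Qed.

Lemma run_rising c k s : run (c :: s) = 1%N -> run (rev (rising c k.+1) ++ s) = k.+1.
Proof.
move=> run1; elim: k => [|k IH]; first by rewrite /= addr0.
move: IH; rewrite !risingSr !rev_rcons !cat_cons => IH.
by rewrite -natr1 addrA run_succ IH.
Qed.

Lemma push_rising c k s : run (c :: s) = 1%N -> (k < n)%N ->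
  foldl push s (rising c k) = rev (rising c k) ++ s.
Proof.
move=> run1; elim: k => // k IH lt_kn; have := run_rising k run1.
rewrite risingSr rev_rcons foldl_rcons IH ?(ltnW lt_kn) // !cat_cons /push => ->.
by rewrite ltn_eqF.
Qed.

(** If [c] does not continue the top run, n - 1 letters pile up and the last one deletes them. If it
    continues a top letter [d], then [s] is the result of pushing [d] on the tail, and
    [rising d n.+1] is pushed on that tail instead: by induction its first n letters cancel, and the
    last one is again [d]. *)
Lemma push_cycle s c : irreducible s -> foldl push s (rising c n) = s.
Proof.
have fresh s' c' : run (c' :: s') = 1%N -> foldl push s' (rising c' n) = s'.
  move=> run1; have := run_rising n.-1 run1.
  rewrite risingSr rev_rcons foldl_rcons push_rising // !cat_cons /push => ->; rewrite eqxx.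
  by rewrite drop_size_cat // size_rev size_map size_iota.
elim: s c => [|d s IH] c irr_s; first exact: fresh.
have [c_d|c_d] := eqVneq c (d + 1); last by apply: fresh; rewrite /= (negPf c_d).
case/andP: (irr_s) => run_ds irr; have d_s : push s d = d :: s.
  by rewrite /push ltn_eqF.
transitivity (foldl push s (rising d n.+1)).
  by rewrite c_d (risingS d) [RHS]/= d_s.
by rewrite risingSr foldl_rcons IH // card_letters0 addr0.
Qed.

(** Once [c] is on top, pushing it again only adds letters, since c <> c + 1; every earlier push
    shortens the stack. This is what drives points out of finite sets. *)
Lemma push_iter_size c s k : (k <= size (iter k (push^~ c) s) + size s)%N.
Proof.
have top j s' : iter j (push^~ c) (c :: s') = nseq j c ++ c :: s'.
  elim: j => //= j ->; rewrite /push.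
  suff -> : run (c :: nseq j c ++ c :: s') = 1%N by [].
  by case: j => [|j] /=; rewrite -[X in X == _]addr0 (inj_eq (addrI c)).
elim: k s => // k IH s; rewrite iterSr.
have [run_n|run_n] := eqVneq (run (c :: s)) n; last first.
  have -> : push s c = c :: s by rewrite /push (negPf run_n).
  by rewrite top size_cat size_nseq -addnA [(size (c :: s) + _)%N]addSn addnS ltnS leq_addr.
have -> : push s c = drop n.-1 s by rewrite /push run_n eqxx.
apply: leq_ltn_trans (IH (drop n.-1 s)) _; rewrite ltn_add2l.
by case: s run_n => [|d s] //= _; rewrite size_drop ltnS leq_subr.
Qed.

Lemma take_run k s : (0 < k <= run s)%N ->
  exists2 c, s = rev (rising c k) ++ drop k s & head 0 s = c + k.-1%:R.
Proof.
elim: s k => [|a s IH] k; first by case: k.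
case: k => // -[_|k] /=.
  by exists a; rewrite ?drop0 /= addr0.
case: s IH => [|b s] // IH; case: eqP => // -> lt_k.
(* The clause on the head identifies the next letter of the block, which lets the induction go
   on. *)
have [c sE hE] := IH k.+1 lt_k; exists c.
  by rewrite risingSr rev_rcons cat_cons -sE -natr1 addrA -[c + _]hE.
by rewrite -natr1 addrA -[c + _]hE.
Qed.

Lemma rising_rot k : (k <= n)%N -> rising k%:R n = rot k e.
Proof.
elim: k => [|k IH] lt_kn; first by rewrite rising0E rot0.
rewrite rotS ?size_ord_enum // -IH ?(ltnW lt_kn) // -natr1 (risingS k%:R) rot1_cons.
by rewrite risingSr -addrA nat1r card_letters0 addr0.
Qed.

Lemma Scong_rising c : Scong (rising c n) e.
Proof.
have -> : c = (val c)%:R by apply/val_inj/esym/natr_letter/ltn_ord.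
by rewrite rising_rot ?(ltnW (ltn_ord c)) //; apply/Scong_sym/Scong_rot.
Qed.

(** Each deleted factor is a rotation of [e], hence equal to z in S_n, and being central it moves to
    the front; [k] counts the deletions. *)
Lemma Scong_push w :
  exists k, Scong w (flatten (nseq k e) ++ rev (foldl push [::] w)).
Proof.
elim/last_ind: w => [|w c [k IH]]; first by exists 0%N; apply: Scong_refl.
rewrite foldl_rcons; set s := foldl _ _ _ in IH *.
have := Scong_catr [:: c] IH; rewrite cats1 -catA cats1 -rev_cons => congr_wc.
rewrite /push; case: eqP => [run_n|_]; last by exists k.
have run_le : (0 < n <= run (c :: s))%N by rewrite run_n leqnn.
have [d sE _] := take_run run_le.
exists k.+1; apply: Scong_trans congr_wc _; rewrite sE rev_cat revK.
rewrite [drop _ _]/= -[k.+1]addn1 nseqD flatten_cat [flatten (nseq 1 e)]cats0 -catA.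
apply: Scong_catl; apply: Scong_trans (Scong_catl _ (Scong_rising d)) _.
exact/Scong_sym/Scong_cycle_central.
Qed.

(** In the form z^k times a stack, each z contains [c] once, so the stack and the number of letters
    [c] determine k. *)
Lemma push_separates c w1 w2 : foldl push [::] w1 = foldl push [::] w2 ->
  count_mem c w1 = count_mem c w2 -> Scong w1 w2.
Proof.
have [k1 w1E] := Scong_push w1; have [k2 w2E] := Scong_push w2.
move=> s_eq; rewrite (permP (Scong_perm w1E)) (permP (Scong_perm w2E)) s_eq.
have count_e k : count_mem c (flatten (nseq k e)) = k.
  rewrite count_flatten map_nseq sumn_nseq count_uniq_mem.
    by rewrite mem_ord_enum mul1n.
  by rewrite -(map_inj_uniq val_inj) val_ord_enum iota_uniq.
rewrite !count_cat !count_e => /addIn k_eq.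
by apply: Scong_trans w1E _; rewrite k_eq s_eq; apply: Scong_sym.
Qed.

End Stacks.

(** * Polynomials in one operator, and independence of resolvents *)

Section PolyAction.
Variables (K : fieldType) (V : lmodType K) (z : {linear V -> V}).

Definition poly_act (p : {poly K}) (v : V) : V :=
  \sum_(i < size p) p`_i *: iter i z v.

Lemma poly_act_widen (p : {poly K}) m v :
  (size p <= m)%N -> poly_act p v = \sum_(i < m) p`_i *: iter i z v.
Proof.
move=> le_pm; rewrite /poly_act (big_ord_widen m (fun i => p`_i *: iter i z v)) //.
rewrite [RHS](bigID (fun i : 'I_m => (i < size p)%N)) /= [X in _ + X]big1 ?addr0 //.
by move=> i; rewrite -leqNgt => le_pi; rewrite nth_default ?scale0r.
Qed.

Lemma poly_actD p q v : poly_act (p + q) v = poly_act p v + poly_act q v.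
Proof.
pose m := maxn (size p) (size q).
rewrite !(@poly_act_widen _ m) ?leq_maxl ?leq_maxr ?(leq_trans (size_polyD _ _)) //.
by rewrite -big_split; apply: eq_bigr => i _; rewrite coefD scalerDl.
Qed.

Lemma poly_actZ c p v : poly_act (c *: p) v = c *: poly_act p v.
Proof.
rewrite !(@poly_act_widen _ (size p)) ?size_scale_leq // scaler_sumr.
by apply: eq_bigr => i _; rewrite coefZ scalerA.
Qed.

Lemma poly_act_sum m (F : 'I_m -> {poly K}) v :
  poly_act (\sum_i F i) v = \sum_i poly_act (F i) v.
Proof.
apply: (big_morph (poly_act^~ v)) => [p q|]; first exact: poly_actD.
by rewrite /poly_act size_poly0 big_ord0.
Qed.

Lemma poly_actC c v : poly_act c%:P v = c *: v.
Proof. by rewrite (poly_act_widen _ (size_polyC_leq1 c)) big_ord1 coefC. Qed.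

Lemma iter_linear i c u v : iter i z (c *: u + v) = c *: iter i z u + iter i z v.
Proof. by elim: i => //= i ->; rewrite linearP. Qed.

Lemma poly_act_linear p : linear (poly_act p).
Proof.
move=> c u v; rewrite /poly_act scaler_sumr -big_split; apply: eq_bigr => i _ /=.
by rewrite iter_linear scalerDr !scalerA mulrC.
Qed.

HB.instance Definition _ p :=
  GRing.isLinear.Build K V V _ (poly_act p) (poly_act_linear p).

Lemma poly_actX p v : poly_act (p * 'X) v = z (poly_act p v).
Proof.
rewrite (@poly_act_widen _ (size p).+1); last first.
  by apply: leq_trans (size_polyMleq _ _) _; rewrite size_polyX addn2.
rewrite big_ord_recl coefMX eqxx scale0r add0r linear_sum.
by apply: eq_bigr => i _; rewrite coefMX /= linearZ.
Qed.

Lemma poly_actM p q v : poly_act (p * q) v = poly_act p (poly_act q v).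
Proof.
elim/poly_ind: p => [|p c IH] in v *.
  by rewrite mul0r /poly_act size_poly0 !big_ord0.
rewrite mulrDl poly_actD -mulrA ['X * q]mulrC mulrA !poly_actX IH mul_polyC.
by rewrite poly_actZ poly_actD poly_actX poly_actC.
Qed.

Lemma poly_act_comm (f : {linear V -> V}) p v :
  (forall u, f (z u) = z (f u)) -> f (poly_act p v) = poly_act p (f v).
Proof.
move=> fz; rewrite /poly_act linear_sum; apply: eq_bigr => i _.
by rewrite linearZ; congr (_ *: _); elim: (nat_of_ord i) => //= j <-.
Qed.

(** Applying the product of all X - l_j to the relation turns it into a polynomial that kills [v0],
    hence is 0; at l_i only the i-th term of this polynomial survives. *)
Lemma resolvents_free m (l : 'I_m -> K) (u : 'I_m -> V) (c : 'I_m -> K) v0 :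
  injective l -> (forall p, poly_act p v0 = 0 -> p = 0) ->
  (forall i, poly_act ('X - (l i)%:P) (u i) = v0) ->
  \sum_i c i *: u i = 0 -> forall i, c i = 0.
Proof.
move=> inj_l tr_v0 u_res sum0 i.
pose R i := \prod_(j < m | j != i) ('X - (l j)%:P).
have /tr_v0/(congr1 (horner^~ (l i))): poly_act (\sum_j c j *: R j) v0 = 0.
  transitivity (poly_act (\prod_j ('X - (l j)%:P)) (\sum_j c j *: u j)).
    rewrite poly_act_sum linear_sum; apply: eq_bigr => j _.
    by rewrite poly_actZ linearZ (bigD1 j) //= mulrC poly_actM u_res.
  by rewrite sum0 linear0.
rewrite horner_sum (bigD1 i) //= big1 => [|j ji]; last first.
  rewrite hornerZ horner_prod (bigD1 i) 1?eq_sym //= hornerXsubC subrr.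
  by rewrite mul0r mulr0.
rewrite addr0 hornerZ horner0 => /eqP; rewrite mulf_eq0 => /orP[/eqP //|].
rewrite horner_prod prodf_seq_eq0 => /hasP[j _ /andP[ji]].
by rewrite !hornerE subr_eq0 => /eqP/inj_l/eqP; rewrite eq_sym (negPf ji).
Qed.

End PolyAction.

(** Otherwise a duplicate-free list in [P] could always be extended, up to length m + 1. *)
Lemma ex_finite_cover (K : eqType) (P : K -> Prop) m :
  (forall s : seq K, uniq s -> (forall x, x \in s -> P x) -> (size s <= m)%N) ->
  exists s : seq K, forall x, P x -> x \in s.
Proof.
move=> bound; apply: contrapT => noS.
suff [s [us Ps sz_s]] : exists s : seq K, [/\ uniq s, forall x, x \in s -> P x & size s = m.+1].
  by have := bound s us Ps; rewrite sz_s ltnn.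
elim: m.+1 => [|k [s [us Ps sz_s]]]; first by exists [::].
have [x [Px xs]] : exists x, P x /\ x \notin s.
  apply: contrapT => nox; apply: noS; exists s => x Px.
  by apply: contrapT => /negP xs; apply: nox; exists x.
by exists (x :: s); split; rewrite /= ?xs ?sz_s // => y; rewrite inE => /predU1P[->|/Ps].
Qed.

Lemma free_of_dim (K : fieldType) (V : lmodType K) m (u : 'I_m.+1 -> V) (b : 'I_m -> V)
    (A : 'M[K]_(m.+1, m)) :
  (forall i, u i = \sum_j A i j *: b j) ->
  exists2 c : 'I_m.+1 -> K, \sum_i c i *: u i = 0 & exists i, c i <> 0.
Proof.
move=> uE; have : kermx A != 0.
  rewrite -mxrank_eq0 mxrank_ker -lt0n subn_gt0 ltnS; exact: rank_leq_col.
case/rowV0Pn => c; rewrite sub_kermx => /eqP cA0 c_neq0.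
exists (c 0).
  under eq_bigr do rewrite uE scaler_sumr.
  rewrite exchange_big big1 // => j _.
  under eq_bigr do rewrite scalerA.
  by rewrite -scaler_suml; move/matrixP/(_ 0 j): cA0; rewrite !mxE => ->; rewrite scale0r.
apply: contrapT => c0; case/eqP: c_neq0; apply/rowP => i; rewrite mxE.
by apply: contrapT => ci; apply: c0; exists i.
Qed.

(** * A faithful simple module forces K to be countable *)

Section RightAction.
Variables (K : fieldType) (V : lmodType K) (n : nat) (T : 'I_n -> {linear V -> V}).

Lemma ract_cat w1 w2 v : ract T (w1 ++ w2) v = ract T w2 (ract T w1 v).
Proof. exact: foldl_cat. Qed.

Lemma ract_linear w : linear (ract T w).
Proof.
by move=> c u v; rewrite /ract; elim: w u v => //= i w IH u v; rewrite linearP IH.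
Qed.

HB.instance Definition _ w := GRing.isLinear.Build K V V _ (ract T w) (ract_linear w).

Hypothesis Trel : Sn_rel (ract T).

Lemma ract_cycle_comm i v :
  T i (ract T (ord_enum n) v) = ract T (ord_enum n) (T i v).
Proof.
have [s [rot_i rot_i1]] := rot_ord_enum i.
by rewrite {1}(Trel i) (Trel i.+1) rot_i rot_i1 -cats1 ract_cat.
Qed.

Hypothesis Tsimple : simple_mod T.

(** Schur's lemma: the kernel and the image of [f] are submodules. *)
Lemma central_inj_surj (f : {linear V -> V}) :
  (forall i v, T i (f v) = f (T i v)) -> (exists v, f v <> 0) ->
  (forall v, f v = 0 -> v = 0) /\ (forall v, exists u, f u = v).
Proof.
case: Tsimple => _ simpleV fT [v0 fv0]; split.
  have subU : submod T (fun v => f v = 0).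
    split=> [|x y fx fy|a x fx|i x fx]; first exact: linear0.
    - by rewrite linearD fx fy addr0.
    - by rewrite linearZ /= fx scaler0.
    - by rewrite -fT fx linear0.
  by case: (simpleV _ subU) => // f0; case: fv0.
have subU : submod T (fun v => exists u, f u = v).
  split=> [|x y [u <-] [w <-]|a x [u <-]|i x [u <-]].
  - by exists 0; rewrite linear0.
  - by exists (u + w); rewrite linearD.
  - by exists (a *: u); rewrite linearZ.
  - by exists (T i u).
by case: (simpleV _ subU) => // im0; case: fv0; apply: im0; exists v0.
Qed.

Lemma simple_spanned v0 : v0 <> 0 ->
  forall v, exists s : seq (K * seq 'I_n), v = \sum_(x <- s) x.1 *: ract T x.2 v0.
Proof.
move=> v0n0; case: Tsimple => _ simpleV.
have subU : submod T (fun v => exists s : seq (K * seq 'I_n),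
    v = \sum_(x <- s) x.1 *: ract T x.2 v0).
  split=> [|x y [s ->] [r ->]|a x [s ->]|i x [s ->]].
  - by exists [::]; rewrite big_nil.
  - by exists (s ++ r); rewrite big_cat.
  - exists [seq (a * x.1, x.2) | x <- s]; rewrite big_map scaler_sumr.
    by apply: eq_bigr => y _; rewrite scalerA.
  - exists [seq (x.1, rcons x.2 i) | x <- s]; rewrite big_map linear_sum.
    by apply: eq_bigr => y _; rewrite linearZ /= -cats1 ract_cat.
case: (simpleV _ subU) => // span0; case: v0n0; apply: span0.
by exists [:: (1, [::])]; rewrite big_seq1 scale1r.
Qed.

Hypothesis n_gt0 : (0 < n)%N.
Hypothesis Tfaithful : faithful_mod (ract T).

Local Notation z := (ract T (ord_enum n)).

(** The powers of [e] have different lengths and congruent words have equal length, so faithfulness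
    applies to the coefficients of [p]. *)
Lemma cycle_poly_neq0 p : p != 0 -> exists v, poly_act z p v <> 0.
Proof.
move=> p_neq0; apply: contrapT => p0.
have e_iter k v : ract T (flatten (nseq k (ord_enum n))) v = iter k z v.
  elim: k v => //= k IH v; rewrite ract_cat IH.
  by elim: k {IH} => //= k <-.
have p_coef0 : forall i : 'I_(size p), p`_i = 0.
  apply: (Tfaithful (w := fun i : 'I_(size p) => flatten (nseq i (ord_enum n)))).
    move=> i j /Scong_perm/perm_size; rewrite !size_flatten /shape !map_nseq !sumn_nseq.
    by rewrite size_ord_enum => /eqP; rewrite eqn_pmul2l // => /eqP/val_inj.
  move=> v; apply: contrapT => pv; apply: p0; exists v.
  by move: pv; under eq_bigr do rewrite e_iter.
have lt_p : ((size p).-1 < size p)%N by rewrite prednK // size_poly_gt0.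
by case/eqP: p_neq0; apply/eqP; rewrite -lead_coef_eq0; apply/eqP/(p_coef0 (Ordinal lt_p)).
Qed.

Lemma right_module_countable : countable_type K.
Proof.
have [[v0 v0_neq0] _] := Tsimple.
have bij (p : {poly K}) : p != 0 -> (forall v, poly_act z p v = 0 -> v = 0) /\
    (forall v, exists u, poly_act z p u = v).
  move=> p_neq0; apply: central_inj_surj; last exact: cycle_poly_neq0.
  by move=> i v; apply: poly_act_comm => u; apply: ract_cycle_comm.
have /choice[u uE] l : exists u, poly_act z ('X - l%:P) u = v0.
  by have [] := bij ('X - l%:P) (negbT (polyXsubC_eq0 l)).
have /choice[s sE] l := simple_spanned v0_neq0 (u l).
pose words l := map snd (s l).
(* All [u l] whose expansion uses the list [ws] lie in the span of [size ws] vectors; being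
   independent, there are at most that many. *)
have /choice[f fE] (ws : seq (seq 'I_n)) :
    exists ls : seq K, forall l, words l = ws -> l \in ls.
  apply: (@ex_finite_cover _ _ (size ws)) => ls uniq_ls lsP.
  rewrite leqNgt; apply/negP => lt_ls; set m := size ws in lt_ls.
  have lt_i (i : 'I_m.+1) : (i < size ls)%N by apply: leq_trans (ltn_ord i) _.
  pose l (i : 'I_m.+1) := nth 0 ls i.
  have inj_l : injective l.
    by move=> i j /eqP; rewrite nth_uniq // => /eqP/val_inj.
  have u_span i : (u \o l) i =
      \sum_(j < m) (\matrix_(i, j) (nth (0, [::]) (s (l i)) j).1) i j *:
        ract T (nth [::] ws j) v0.
    have wsE : words (l i) = ws by apply/lsP/mem_nth.
    have sz_s : size (s (l i)) = m by rewrite /m -wsE size_map.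
    rewrite /= [LHS]sE (big_nth (0, [::])) big_mkord sz_s.
    apply: eq_bigr => j _; rewrite mxE -[in RHS]wsE (nth_map (0, [::])) //.
    by rewrite sz_s.
  have [c sum0 [i []]] := free_of_dim u_span.
  apply: (resolvents_free inj_l _ _ sum0) => [p pv0|j]; last exact: uE.
  by apply: contrapT => /eqP/bij[/(_ _ pv0)].
(* A scalar is coded by its list of words and its position in the finite list that covers all
   scalars with those words. *)
exists (fun l => pickle (words l, index l (f (words l)))) => l1 l2.
move/(pcan_inj pickleK) => [ws_eq]; rewrite -ws_eq => /(congr1 (nth 0 (f (words l1)))).
by rewrite !nth_index ?fE.
Qed.

End RightAction.

(** * Disjoint finite sets, and linear maps on a free module *)

Lemma disjoint_choice (X : eqType) (P : nat -> seq X -> Prop) :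
  (forall k (B : seq X), exists s : seq X, P k s /\ (forall x, x \in s -> x \notin B)) ->
  exists s : nat -> seq X, (forall k, P k (s k)) /\
    (forall j k x, x \in s j -> x \in s k -> j = k).
Proof.
move=> step; have /choice[f fP] (kB : nat * seq X) := step kB.1 kB.2.
(* Stage [k] must avoid everything chosen at the earlier stages. *)
pose used := fix used k := if k is j.+1 then used j ++ f (j, used j) else [::].
exists (fun k => f (k, used k)); split=> [k|j k x]; first by have [] := fP (k, used k).
have used_lt i l : (i < l)%N -> x \in f (i, used i) -> x \in used l.
  elim: l => // l IH; rewrite ltnS leq_eqVlt mem_cat => /predU1P[->|/IH IHi] xi.
    by rewrite xi orbT.
  by rewrite IHi.
have [lt_jk xj xk|lt_kj xj xk|//] := ltngtP j k.
- by have [_ /(_ x xk)/negP[]] := fP (k, used k); apply: used_lt xj.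
- by have [_ /(_ x xj)/negP[]] := fP (j, used j); apply: used_lt xk.
Qed.

Section FreeModule.
Variables (F : fieldType) (X : choiceType).
Local Notation V := {freeg X / F}.
Implicit Types (u v : V) (x : X).

Definition basis x : V := Freeg [:: (1, x)].

Lemma coeff_basis x y : coeff y (basis x) = (x == y)%:R.
Proof. by rewrite coeffU mul1r. Qed.

Lemma basis_sum v : v = \sum_(x <- dom v) coeff x v *: basis x.
Proof.
rewrite -[LHS]freeg_sumE; apply: eq_bigr => x _.
apply/eqP/freeg_eqP => y; rewrite coeffZ !coeffU mul1r //.
Qed.

Definition lin_ext (f : X -> V) v : V := \sum_(x <- dom v) coeff x v *: f x.

Lemma lin_ext_sum f v (s : seq X) : uniq s -> {subset dom v <= s} ->
  lin_ext f v = \sum_(x <- s) coeff x v *: f x.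
Proof.
move=> us sub; rewrite [RHS](bigID (mem (dom v))) /= [X in _ + X]big1 => [|x]; last first.
  by move/coeff_outdom ->; rewrite scale0r.
rewrite addr0 -big_filter; apply: perm_big; apply: uniq_perm; rewrite ?uniq_dom //.
  exact: filter_uniq.
by move=> x; rewrite mem_filter andb_idr //; apply: sub.
Qed.

Lemma lin_ext_linear f : linear (lin_ext f).
Proof.
move=> c u v; pose s := undup (dom u ++ dom v).
have us : uniq s by apply: undup_uniq.
rewrite !(@lin_ext_sum f _ s) // => [|x|x|x]; last 3 first.
- by rewrite mem_undup mem_cat => ->; rewrite orbT.
- by rewrite mem_undup mem_cat => ->.
- by move=> /domD_subset; rewrite mem_undup !mem_cat => /orP[/domZ_subset ->|->]; rewrite ?orbT.
rewrite scaler_sumr -big_split; apply: eq_bigr => x _ /=.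
by rewrite coeffD coeffZ scalerDl scalerA.
Qed.

HB.instance Definition _ f :=
  GRing.isLinear.Build F V V _ (lin_ext f) (lin_ext_linear f).

Lemma lin_ext_basis f x : lin_ext f (basis x) = f x.
Proof.
rewrite (@lin_ext_sum f _ [:: x]) ?domU1 //.
by rewrite big_seq1 coeff_basis eqxx scale1r.
Qed.

Lemma linear_basis_eq (f g : {linear V -> V}) :
  (forall x, f (basis x) = g (basis x)) -> f =1 g.
Proof.
move=> fg v; rewrite (basis_sum v) !linear_sum; apply: eq_bigr => x _.
by rewrite !linearZ /= fg.
Qed.

End FreeModule.

(** * An involution exchanging prescribed pairs of vectors *)

Section Swap.
Variables (F : fieldType) (X : choiceType) (I : Type).
Local Notation V := {freeg X / F}.
Variables (p q : I -> V) (y y' : I -> X) (block : X -> option I).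
(** Disjointness of the supports for different indices is expressed by a labelling of the points. *)
Hypothesis p_block : forall i x, x \in dom (p i) -> block x = Some i.
Hypothesis q_block : forall i x, x \in dom (q i) -> block x = Some i.
Hypothesis y_p : forall i, y i \in dom (p i).
Hypothesis y_q : forall i, y i \notin dom (q i).
Hypothesis y'_p : forall i, y' i \notin dom (p i).
Hypothesis y'_q : forall i, y' i \in dom (q i).

(** The point [y i] sees [p i] but not [q i], and [y' i] the reverse, so the form is 1 on [p i] and
    -1 on [q i]: adding this multiple of [q i - p i] exchanges the two. *)
Definition swap_form i (v : V) : F :=
  coeff (y i) v / coeff (y i) (p i) - coeff (y' i) v / coeff (y' i) (q i).

Lemma swap_form_linear i : scalar (swap_form i).
Proof. by move=> c u v; rewrite /swap_form !coeffD !coeffZ; ring. Qed.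

HB.instance Definition _ i :=
  GRing.isLinear.Build F V F _ (swap_form i) (swap_form_linear i).

(* The reflections along [q i - p i] commute, having disjoint supports; this is their product. *)
Definition swap : V -> V := lin_ext (fun x =>
  basis F x + if block x is Some i then swap_form i (basis F x) *: (q i - p i) else 0).

HB.instance Definition _ := GRing.Linear.on swap.

Lemma swap_out x : block x = None -> swap (basis F x) = basis F x.
Proof. by move=> xN; rewrite /swap lin_ext_basis xN addr0. Qed.

Lemma swap_in i v : (forall x, x \in dom v -> block x = Some i) ->
  swap v = v + swap_form i v *: (q i - p i).
Proof.
move=> v_block; rewrite {2 3}(basis_sum v) linear_sum scaler_suml -big_split.
rewrite /swap /lin_ext big_seq [RHS]big_seq; apply: eq_bigr => x /v_block ->.
by rewrite scalerDr scalerA linearZ.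
Qed.

Lemma swap_form_p i : swap_form i (p i) = 1.
Proof.
rewrite /swap_form divff; last by rewrite -mem_dom.
by rewrite (coeff_outdom (y'_p i)) mul0r subr0.
Qed.

Lemma swap_form_q i : swap_form i (q i) = - 1.
Proof.
rewrite /swap_form divff; last by rewrite -mem_dom.
by rewrite (coeff_outdom (y_q i)) mul0r sub0r.
Qed.

Lemma swap_p i : swap (p i) = q i.
Proof. by rewrite (swap_in (@p_block i)) swap_form_p scale1r addrC subrK. Qed.

Lemma swap_q i : swap (q i) = p i.
Proof.
by rewrite (swap_in (@q_block i)) swap_form_q scaleN1r opprB addrC subrK.
Qed.

(** On a basis vector of block [i], the first application adds a multiple of [q i - p i], whose sign
    the second one reverses. *)
Lemma swapK : involutive swap.
Proof.
move=> v; rewrite -[RHS]/(idfun v) -[LHS]/((swap \o swap) v).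
apply: linear_basis_eq => x /=.
case xE: (block x) => [i|]; last by rewrite !swap_out.
rewrite {2}/swap lin_ext_basis xE linearD linearZ linearB /= swap_p swap_q.
rewrite (@swap_in i) => [|z]; last by rewrite domU1 inE => /eqP ->.
by rewrite -addrA -scalerDr addrA subrK subrr scaler0 addr0.
Qed.

End Swap.

(** * Twisting a permutation action by an involution *)

Section Operators.
Variables (F : fieldType) (X : choiceType) (m : nat).
Local Notation n := m.+3.
Local Notation e := (ord_enum n).
Local Notation V := {freeg X / F}.
Variable sigma : X -> 'I_n -> X.
Implicit Types (u v : V) (w : seq 'I_n).

Definition walk w : V -> V := lin_ext (fun x => basis F (foldl sigma x w)).

HB.instance Definition _ w := GRing.Linear.on (walk w).

Lemma walk_basis w x : walk w (basis F x) = basis F (foldl sigma x w).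
Proof. exact: lin_ext_basis. Qed.

Lemma walk_cat w1 w2 v : walk (w1 ++ w2) v = walk w2 (walk w1 v).
Proof.
rewrite -[RHS]/((walk w2 \o walk w1) v).
by apply: linear_basis_eq => x /=; rewrite !walk_basis foldl_cat.
Qed.

Lemma walk_fixed w : (forall x, foldl sigma x w = x) -> walk w =1 id.
Proof.
move=> w_id v; rewrite -[RHS]/(idfun v).
by apply: linear_basis_eq => x /=; rewrite walk_basis w_id.
Qed.

Lemma dom_walk w v x : x \in dom (walk w v) ->
  exists2 z, z \in dom v & x = foldl sigma z w.
Proof.
rewrite /walk /lin_ext => /dom_sum_subset/flattenP[s /mapP[z]].
rewrite filter_predT => z_v -> /domZ_subset; rewrite domU1 inE => /eqP ->.
by exists z.
Qed.

Hypothesis sigma_cycle : forall k x, foldl sigma x (rot k e) = x.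

(** The words [i :: s] and [rcons s i] are both rotations of [e] and act trivially, so [s] is a
    two-sided inverse of the letter [i]. *)
Lemma inverse_word w : exists w', (forall x, foldl sigma (foldl sigma x w) w' = x) /\
  (forall x, foldl sigma (foldl sigma x w') w = x).
Proof.
elim: w => [|i w [w' [ww' w'w]]]; first by exists [::].
have [s [rot_i rot_i1]] := rot_ord_enum i.
exists (w' ++ s); split=> x; rewrite -foldl_cat; last first.
  rewrite -catA -cat_rcons foldl_cat foldl_cat -rot_i1 sigma_cycle.
  exact: w'w.
rewrite cat_cons /= !foldl_cat ww' -[LHS]/(foldl sigma x (i :: s)) -rot_i.
exact: sigma_cycle.
Qed.

Lemma walk_inj w v : walk w v = 0 -> v = 0.
Proof.
have [w' [ww' _]] := inverse_word w => wv0.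
rewrite -[v](@walk_fixed (w ++ w')) ?walk_cat ?wv0 ?linear0 // => x.
by rewrite foldl_cat.
Qed.

Variables (t : F) (E : {linear V -> V}).
Hypothesis t_neq0 : t != 0.
Hypothesis EK : involutive E.

(* The letter 0 acts by [E] and then [sigma], the last letter by [sigma], then [E], then
   [t]: since [E] is an involution, the word [e] acts by the scalar [t]. *)
Definition generator_fun (i : 'I_n) (v : V) : V :=
  let v' := walk [:: i] (if i == 0 then E v else v) in
  if i == ord_max then t *: E v' else v'.

Lemma generator_linear i : linear (generator_fun i).
Proof.
move=> c u v; rewrite /generator_fun; do 2!case: ifP => _; rewrite !linearP //=.
all: by rewrite scalerDr !scalerA mulrC.
Qed.

HB.instance Definition _ i := GRing.isLinear.Build F V V _ (generator_fun i) (generator_linear i).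

Definition generator i : {linear V -> V} := generator_fun i.

Lemma ract_walk w v : 0 \notin w -> ord_max \notin w -> ract generator w v = walk w v.
Proof.
elim: w v => [|i w IH] v; first by rewrite walk_fixed.
rewrite !inE !negb_or => /andP[i0 w0] /andP[i_max w_max].
rewrite -cat1s walk_cat /= -IH //; congr (ract _ _ _).
by rewrite /= /generator_fun ![i == _]eq_sym (negPf i0) (negPf i_max).
Qed.

Lemma ract_link N M v : ract generator (nseq N 1 ++ 0 :: nseq M 1) v =
  walk (0 :: nseq M 1) (E (walk (nseq N 1) v)).
Proof.
(* As n >= 3, the letter 1 is not twisted; [E] enters only once, just before [sigma] at the letter
   0. *)
have clean k : (0 \notin nseq k (1 : 'I_n)) && (ord_max \notin nseq k (1 : 'I_n)).
  by rewrite !mem_nseq !andbF.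
have [/andP[N0 N_max] /andP[M0 M_max]] := (clean N, clean M).
rewrite ract_cat (ract_walk _ N0 N_max) -[0 :: _]cat1s ract_cat walk_cat.
exact: ract_walk.
Qed.

(** Only the two ends of [e] are twisted: [E] acts, then the whole walk along [e], which is the
    identity, then [E] and t. *)
Lemma ract_generator_cycle v : ract generator e v = t *: v.
Proof.
have [s [e_s _]] := rot_ord_enum (0 : 'I_n).
have [s' [_ e_s']] := rot_ord_enum (ord_max : 'I_n).
rewrite rot0 in e_s; rewrite rot_oversize ?size_ord_enum // in e_s'.
have [mid s_mid] : exists mid, s = rcons mid ord_max.
  case/lastP: s e_s => [|mid j] e_s; first by have := size_ord_enum n; rewrite e_s.
  by exists mid; move: e_s'; rewrite e_s -rcons_cons => /rcons_inj[_ <-].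
have uniq_e : uniq e by rewrite -(map_inj_uniq val_inj) val_ord_enum iota_uniq.
rewrite s_mid in e_s; move: uniq_e; rewrite e_s /= rcons_uniq mem_rcons inE negb_or.
case/and3P=> /andP[_ mid0] mid_max _.
rewrite -cats1 -cat1s !ract_cat /= ract_walk //.
have -> : generator 0 v = walk [:: 0] (E v) by [].
rewrite /= /generator_fun /= eqxx -!walk_cat /= cats1 -e_s walk_fixed ?EK // => x.
by have := sigma_cycle 0 x; rewrite rot0.
Qed.

Lemma ract_generator_surj w v : exists u, ract generator w u = v.
Proof.
elim: w v => [|i w IH] v; first by exists v.
have [u <-] := IH v; suff [u' <-] : exists u', generator i u' = u by exists u'.
have walk_surj u' : exists u'', walk [:: i] u'' = u'.
  have [w' [_ w'i]] := inverse_word [:: i]; exists (walk w' u').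
  by rewrite -walk_cat walk_fixed // => x; rewrite foldl_cat.
have [u1 u1E] := walk_surj (if i == ord_max then t^-1 *: E u else u).
exists (if i == 0 then E u1 else u1); rewrite /= /generator_fun.
have -> : (if i == 0 then E (if i == 0 then E u1 else u1)
           else if i == 0 then E u1 else u1) = u1 by case: eqP; rewrite ?EK.
rewrite u1E; case: eqP => // _.
by rewrite linearZ /= EK scalerA divff // scale1r.
Qed.

(** Write v as the image of some u under [take k e]; then [rot k e] acts on v as [e] followed by
    [take k e] acts on u, which gives t v. *)
Lemma Sn_rel_generator : Sn_rel (ract generator).
Proof.
move=> k v; rewrite ract_generator_cycle; have [u <-] := ract_generator_surj (take k e) v.
rewrite /rot ract_cat -(ract_cat _ (take k e)) cat_take_drop ract_generator_cycle.
by rewrite linearZ.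
Qed.

Lemma ract_generator_basis w x :
  (forall j, E (basis F (foldl sigma x (take j w))) = basis F (foldl sigma x (take j w))) ->
  ract generator w (basis F x) = t ^+ count_mem ord_max w *: basis F (foldl sigma x w).
Proof.
elim: w x => [|i w IH] x fixE /=; first by rewrite expr0 scale1r.
have genE : generator i (basis F x) = t ^+ (i == ord_max) *: basis F (sigma x i).
  have := fixE 0%N; rewrite /= /generator_fun => ->; rewrite if_same walk_basis.
  have := fixE 1%N; rewrite [take _ _]/= take0 /= => ->.
  by case: eqP => _; rewrite ?expr1 ?expr0 ?scale1r.
rewrite genE linearZ /= IH; last by move=> j; apply: (fixE j.+1).
by rewrite scalerA -exprD.
Qed.

End Operators.

(** * Recursive construction of the generic involution *)

Section GenericSwap.
Variables (F : fieldType) (X : choiceType) (m : nat).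
Local Notation n := m.+3.
Local Notation e := (ord_enum n).
Local Notation V := {freeg X / F}.
Variable sigma : X -> 'I_n -> X.
Local Notation walk := (@walk F X m sigma).
Hypothesis sigma_cycle : forall k x, foldl sigma x (rot k e) = x.

(** Where [E] is not met, a word sends [basis F x] to a power of t times its endpoint, the exponent
    being the number of letters [ord_max]; for such [x] these data determine the element of S_n. *)
Definition separating x := forall w1 w2 : seq 'I_n,
  foldl sigma x w1 = foldl sigma x w2 ->
  count_mem ord_max w1 = count_mem ord_max w2 -> Scong w1 w2.

Definition visited (x : X) (W : seq (seq 'I_n)) : seq X :=
  flatten [seq [seq foldl sigma x (take j w) | j <- iota 0 (size w).+1] | w <- W].

Lemma mem_visited x W w j : w \in W -> foldl sigma x (take j w) \in visited x W.
Proof.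
move=> wW; apply/flatten_mapP; exists w => //; apply/mapP.
have [le_jw|/ltnW le_wj] := leqP j (size w); first by exists j; rewrite // mem_iota.
by exists (size w); rewrite ?mem_iota //= take_size take_oversize.
Qed.

Hypothesis sigma_escape : forall S B : seq X,
  exists N, forall x, x \in S -> foldl sigma x (nseq N 1) \notin B.
Hypothesis sigma_reserve : forall W (B : seq X),
  exists x, separating x /\ (forall z, z \in visited x W -> z \notin B).

Variables (C : countType) (decode : C -> V).
Hypothesis decode_surj : forall v, exists c, decode c = v.

(** If [E] sends [p] to [q], then N letters 1, the letter 0 and M letters 1 carry [u] to [v]. *)
Definition linked u v p q (s : seq X) : Prop :=
  [/\ exists N, p = walk (nseq N 1) u, exists M, walk (0 :: nseq M 1) q = v,
      forall x, x \in dom p -> x \notin dom q & s = dom p ++ dom q].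

Lemma exists_linked u v (B : seq X) :
  exists s, (exists p q, linked u v p q s) /\ (forall x, x \in s -> x \notin B).
Proof.
have [N escN] := sigma_escape (dom u) B; pose p := walk (nseq N 1) u.
have pB x : x \in dom p -> x \notin B by move=> /dom_walk[z /escN zB ->].
(* Escape is applied forwards to the forbidden points: the letter 0 and then M letters 1 take them
   off the support of [v], so none lies in the support of the preimage [q]. *)
have [M escM] := sigma_escape [seq sigma x 0 | x <- B ++ dom p] (dom v).
have [w' [_ w'w]] := inverse_word sigma_cycle (0 :: nseq M 1).
pose q := walk w' v.
have qBp x : x \in dom q -> x \notin B ++ dom p.
  case/dom_walk=> z zv ->; apply/negP => /(map_f (sigma^~ 0))/escM/negP[].
  by have := w'w z; rewrite /= => ->.
exists (dom p ++ dom q); split=> [|x].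
  exists p, q; split=> //; first by exists N.
    by exists M; rewrite /q -walk_cat walk_fixed // => x; rewrite foldl_cat.
  by move=> x xp; apply/negP => /qBp; rewrite mem_cat xp orbT.
by rewrite mem_cat => /orP[/pB //|/qBp]; rewrite mem_cat negb_or => /andP[].
Qed.

(* The [k]-th task is to link two vectors, or to keep the swap away from the paths that
   some words trace from a separating point. *)
Definition task_spec (k : nat) (s : seq X) : Prop :=
  match unpickle k : option (C * C + seq (seq 'I_n)) with
  | Some (inl (a, b)) => exists p q, linked (decode a) (decode b) p q s
  | Some (inr W) => exists x, separating x /\ s = visited x W
  | None => True
  end.

Lemma exists_generic_swap : exists E : {linear V -> V},
  [/\ involutive E,
      forall u v, u != 0 -> v != 0 -> exists N M,
        walk (0 :: nseq M 1) (E (walk (nseq N 1) u)) = v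
    & forall W, exists2 x, separating x & forall z, z \in visited x W ->
        E (basis F z) = basis F z].
Proof.
have [s [sP s_disj]] : exists s : nat -> seq X, (forall k, task_spec k (s k)) /\
    (forall j k x, x \in s j -> x \in s k -> j = k).
  apply: disjoint_choice => k B; rewrite /task_spec.
  case: unpickle => [[[a b]|W]|]; last by exists [::].
    exact: exists_linked.
  by have [x [sep_x xB]] := sigma_reserve W B; exists (visited x W); split=> //; exists x.
(* Nonzero vectors have nonempty supports, which supply the points [y] and [y']. As [decode] may
   repeat values, one task is then selected per pair. *)
pose I := {uv : V * V | (uv.1 != 0) && (uv.2 != 0)}.
have /choice[idx idxP] (i : I) : exists k : nat, exists a b,
    [/\ unpickle k = Some (inl (a, b) : C * C + seq (seq 'I_n)),
        decode a = (val i).1 & decode b = (val i).2].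
  have [a aE] := decode_surj (val i).1; have [b bE] := decode_surj (val i).2.
  by exists (pickle (inl (a, b) : C * C + seq (seq 'I_n))), a, b; rewrite pickleK.
have idx_inj : injective idx.
  move=> i j ij; have [a [b [ka au bv]]] := idxP i; have [a' [b' [ka' au' bv']]] := idxP j.
  move: ka'; rewrite -ij ka => -[aa' bb']; apply: val_inj.
  by rewrite [val i]surjective_pairing [val j]surjective_pairing -au -bv aa' bb' au' bv'.
have /choice[pq pqP] (i : I) :
    exists pq : V * V, linked (val i).1 (val i).2 pq.1 pq.2 (s (idx i)).
  have [a [b [ka <- <-]]] := idxP i; have := sP (idx i).
  by rewrite /task_spec ka => -[p [q ?]]; exists (p, q).
pose p i := (pq i).1; pose q i := (pq i).2.
have mem_dom_neq0 (v : V) : v != 0 -> exists x, x \in dom v.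
  by rewrite -dom_eq0; case: (dom v) => // x r _; exists x; rewrite inE eqxx.
have /choice[y y_p] i : exists x, x \in dom (p i).
  have [[N pE] _ _ _] := pqP i; apply: mem_dom_neq0; rewrite /p pE.
  by apply/eqP => /(walk_inj sigma_cycle)/eqP; case/andP: (valP i) => /negPf->.
have /choice[y' y'_q] i : exists x, x \in dom (q i).
  have [_ [M qE] _ _] := pqP i; apply: mem_dom_neq0; apply/eqP => q0.
  by case/andP: (valP i) => _; rewrite -qE -/(q i) q0 linear0 eqxx.
have disj i x : x \in dom (p i) -> x \notin dom (q i) by have [_ _ + _] := pqP i; apply.
have sE i : s (idx i) = dom (p i) ++ dom (q i) by have [] := pqP i.
(* A point belongs to at most one selected task, as the sets [s k] are disjoint and [idx] is
   injective. *)
have /choice[block blockP] x : exists o : option I,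
    (forall i, x \in s (idx i) -> o = Some i) /\ ((forall i, x \notin s (idx i)) -> o = None).
  have [[i xi]|nox] := pselect (exists i, x \in s (idx i)).
    exists (Some i); split=> [j xj|/(_ i)/negP //].
    by congr Some; apply/idx_inj/(s_disj _ _ x).
  by exists None; split=> // i xi; case: nox; exists i.
have p_block i x : x \in dom (p i) -> block x = Some i.
  by move=> xp; apply: (blockP x).1; rewrite sE mem_cat xp.
have q_block i x : x \in dom (q i) -> block x = Some i.
  by move=> xq; apply: (blockP x).1; rewrite sE mem_cat xq orbT.
have y_q i : y i \notin dom (q i) by apply: disj.
have y'_p i : y' i \notin dom (p i) by apply/negP => /disj/negP[].
exists (swap p q y y' block); split.
- exact: swapK.
- move=> u v u_neq0 v_neq0; have uv : (u != 0) && (v != 0) by rewrite u_neq0.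
  have [[N pE] [M qE] _ _] := pqP (exist _ (u, v) uv); exists N, M.
  by rewrite -[walk _ u]pE -[RHS]qE /= swap_p.
- move=> W; have := sP (pickle (inr W : C * C + seq (seq 'I_n))).
  rewrite /task_spec pickleK => -[x [sep_x sW]]; exists x => // z zW.
  (* A visited point in some block would lie in the sets of two tasks of different kinds. *)
  apply: swap_out; apply: (blockP z).2 => i; apply/negP => zi.
  have [a [b [ki _ _]]] := idxP i; move: zW; rewrite -sW => /s_disj/(_ zi) ik.
  by move: ki; rewrite -ik pickleK.
Qed.

End GenericSwap.

(** * Fractions, and the action of letters on copies of the free group *)

Lemma fraction_ratio (R : idomainType) (x : {fraction R}) :
  exists a b : R, x = tofrac a / tofrac b.
Proof.
elim/quotW: x => r; exists \n_r, \d_r; apply: canRL (mulfK _) _.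
  by rewrite tofrac_eq0 denom_ratioP.
rewrite /GRing.mul /= !piE; apply/eqP; rewrite FracField.equivf_def.
rewrite /FracField.mulf !numden_Ratio ?mulf_neq0 ?oner_eq0 ?denom_ratioP //.
by rewrite !mulr1 mulrC.
Qed.

Lemma foldl_nseq (A B : Type) (f : A -> B -> A) x b N :
  foldl f x (nseq N b) = iter N (f^~ b) x.
Proof. by elim: N x => // N IH x; rewrite iterSr -IH. Qed.

Section StackAction.
Variable m : nat.
Local Notation n := m.+3.
Local Notation stack := {s : seq 'I_n | irreducible s}.

Definition spush (s : stack) c : stack :=
  exist _ (push (val s) c) (push_irreducible c (valP s)).

Definition letter (x : nat * stack) c : nat * stack := (x.1, spush x.2 c).

Lemma val_foldl_letter x w :
  (foldl letter x w).1 = x.1 /\ val (foldl letter x w).2 = foldl (@push m) (val x.2) w.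
Proof. by elim: w x => //= c w IH x; have [-> ->] := IH (letter x c). Qed.

Lemma letter_cycle k x : foldl letter x (rot k (ord_enum n)) = x.
Proof.
wlog le_kn : k / (k <= n)%N => [hw|].
  have [/hw //|lt_nk] := leqP k n.
  rewrite rot_oversize ?size_ord_enum 1?ltnW //.
  by have := hw 0%N isT; rewrite rot0.
have [x1 x2] := val_foldl_letter x (rot k (ord_enum n)).
rewrite [LHS]surjective_pairing [RHS]surjective_pairing x1; congr (_, _).
by apply: val_inj; rewrite x2 -rising_rot // push_cycle //; apply: valP.
Qed.

Lemma letter_escape (S B : seq (nat * stack)) :
  exists N, forall x, x \in S -> foldl letter x (nseq N 1) \notin B.
Proof.
pose sz (x : nat * stack) := size (val x.2); set a := \max_(x <- S) sz x.
have le_sz x r : x \in r -> (sz x <= \max_(z <- r) sz z)%N.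
  by move=> xr; apply: leq_bigmax_seq.
(* This exceeds the sum of the largest stack sizes in [S] and [B], against the bound of
   [push_iter_size]. *)
exists (a + \max_(x <- B) sz x).+1 => x xS; apply/negP => /le_sz le_B.
have := push_iter_size 1 (val x.2) (a + \max_(x <- B) sz x).+1.
rewrite -foldl_nseq -(val_foldl_letter _ _).2 => /leq_trans/(_ (leq_add le_B _)).
by move/(_ _ (le_sz _ _ xS)); rewrite addnC ltnn.
Qed.

Lemma letter_reserve W (B : seq (nat * stack)) :
  exists x, separating letter x /\ (forall z, z \in visited letter x W -> z \notin B).
Proof.
(* The empty stack in a copy whose index exceeds all those in [B]; letters never change the copy. *)
exists ((\max_(b <- B) b.1).+1, exist _ [::] isT); split=> [w1 w2 w12|z].
  apply: push_separates; move: (congr1 (fun x => val x.2) w12).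
  by rewrite !(val_foldl_letter _ _).2.
case/flatten_mapP=> w _ /mapP[j _ ->]; apply/negP; set z' := foldl _ _ _ => z'B.
have : (z'.1 <= \max_(b <- B) b.1)%N by apply: leq_bigmax_seq.
by rewrite (val_foldl_letter _ _).1 ltnn.
Qed.

End StackAction.

(** * Restriction of scalars *)

Definition restrict_scalars (K F : fieldType) (iota : {rmorphism K -> F})
  (V : lmodType F) : Type := V.

Section RestrictScalars.
Variables (K F : fieldType) (iota : {rmorphism K -> F}) (V : lmodType F).
Local Notation restrict := (restrict_scalars iota V).

HB.instance Definition _ := GRing.Zmodule.on restrict.

(** The alias [restrict] records [iota], which keeps this K-structure apart from the F-structure of
    [V]. *)
Definition restrict_scale (a : K) (v : restrict) : restrict := iota a *: (v : V).

Fact restrict_scaleA a b v : restrict_scale a (restrict_scale b v) = restrict_scale (a * b) v.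
Proof. by rewrite /restrict_scale scalerA rmorphM. Qed.

Fact restrict_scale1 : left_id 1 restrict_scale.
Proof. by move=> v; rewrite /restrict_scale rmorph1 scale1r. Qed.

Fact restrict_scaleDr : right_distributive restrict_scale +%R.
Proof. by move=> a u v; apply: scalerDr. Qed.

Fact restrict_scaleDl v : {morph restrict_scale^~ v : a b / a + b}.
Proof. by move=> a b; rewrite /restrict_scale rmorphD scalerDl. Qed.

HB.instance Definition _ := GRing.Zmodule_isLmodule.Build K restrict
  restrict_scaleA restrict_scale1 restrict_scaleDr restrict_scaleDl.

Variable f : {linear V -> V}.

Definition restrict_map (v : restrict) : restrict := f v.

Fact restrict_map_linear : linear restrict_map.
Proof. by move=> a u v; apply: linearP. Qed.

HB.instance Definition _ :=
  GRing.isLinear.Build K restrict restrict _ restrict_map restrict_map_linear.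

End RestrictScalars.

Lemma countable_enum (K : nmodType) : countable_type K ->
  exists g : nat -> K, forall x, exists k, g k = x.
Proof.
case=> f inj_f; have /choice[g gP] k : exists x : K, forall y, f y = k -> x = y.
  have [[x <-]|nox] := pselect (exists x, f x = k).
    by exists x => y /inj_f.
  by exists 0 => y fy; case: nox; exists y.
by exists g => x; exists (f x); apply: gP.
Qed.

(** * The faithful simple module over a countable field *)

Section CountableField.
Variables (K : fieldType) (m : nat).
Local Notation n := m.+3.
Local Notation X := (nat * {s : seq 'I_n | irreducible s})%type.
Local Notation F := {fraction {poly K}}.
Local Notation V := {freeg X / F}.
Local Notation t := (tofrac 'X : F).
Local Notation scalars := (@tofrac _ \o @polyC K : {rmorphism K -> F}).

Lemma tofrac_monomials k (a : 'I_k -> nat) (c : 'I_k -> K) :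
  \sum_i scalars (c i) * t ^+ a i = 0 -> forall j, \sum_(i | a i == a j) c i = 0.
Proof.
move=> sum0 j; have /eqP : tofrac (\sum_i c i *: 'X^(a i)) = 0 :> F.
  rewrite -[RHS]sum0 rmorph_sum; apply: eq_bigr => i _.
  by rewrite -mul_polyC rmorphM rmorphXn.
rewrite tofrac_eq0 => /eqP/(congr1 (fun p : {poly K} => p`_(a j))); rewrite coef0 coef_sum => coef0.
rewrite -[RHS]coef0 [LHS]big_mkcond; apply: eq_bigr => i _; rewrite coefZ coefXn eq_sym.
by case: eqP => _; rewrite ?mulr1 ?mulr0.
Qed.

Lemma freeg_decode : countable_type K ->
  exists (C : countType) (decode : C -> V), forall v, exists c, decode c = v.
Proof.
case/countable_enum=> g g_surj.
have poly_surj (p : {poly K}) : exists s, Poly (map g s) = p.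
  have /choice[h hP] x := g_surj x; exists (map h p).
  by rewrite -map_comp -[RHS]polyseqK; congr Poly; apply: map_id_in => x _; apply: hP.
pose frac (ab : seq nat * seq nat) : F :=
  tofrac (Poly (map g ab.1)) / tofrac (Poly (map g ab.2)).
have /choice[h hP] x : exists ab, frac ab = x.
  have [a [b ->]] := fraction_ratio x.
  by have [[s <-] [r <-]] := (poly_surj a, poly_surj b); exists (s, r).
exists (seq ((seq nat * seq nat) * X))%type.
exists (fun c => \sum_(ax <- c) frac ax.1 *: basis F ax.2) => v.
exists [seq (h (coeff x v), x) | x <- dom v].
by rewrite big_map [RHS]basis_sum; apply: eq_bigr => x _; rewrite hP.
Qed.

Lemma right_primitive_of_countable : countable_type K -> right_primitive_Sn K n.
Proof.
case/freeg_decode=> C [decode decode_surj].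
have [E [EK link free]] := exists_generic_swap (@letter_cycle m) (@letter_escape m)
  (@letter_reserve m) decode_surj.
have t_neq0 : t != 0 by rewrite tofrac_eq0 polyX_eq0.
pose genE := generator (@letter m) t E.
pose T (i : 'I_n) : {linear restrict_scalars scalars V -> restrict_scalars scalars V} :=
  @restrict_map K F scalars V (genE i).
have ractE w v : ract T w v = ract genE w v by [].
exists (restrict_scalars scalars V), T; split.
- exact: (Sn_rel_generator (@letter_cycle m) t_neq0 EK).
- split=> [|U [U0 _ _ UT]].
    exists (basis F (0%N, exist _ [::] isT)); apply/eqP.
    by rewrite /basis freegU_eq0 oner_eq0.
  have [[v [Uv /eqP v_neq0]]|noU] := pselect (exists v, U v /\ v <> 0); last first.
    by left=> v Uv; apply: contrapT => v0; apply: noU; exists v.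
  right=> u; have [->|u_neq0] := eqVneq u 0; first exact: U0.
  have Uw w x : U x -> U (ract T w x) by elim: w x => //= i w IH x /(UT i)/IH.
  (* A single word carries the nonzero [v] of [U] to any nonzero [u]. *)
  have [N [M <-]] := link v u v_neq0 u_neq0.
  rewrite -(ract_link _ t); exact: (Uw (nseq N 1 ++ 0 :: nseq M 1)).
- move=> r w c w_inj sum0 j.
  have [x sep_x xE] := free (codom w).
  have ract_x i : ract genE (w i) (basis F x) =
      t ^+ count_mem ord_max (w i) *: basis F (foldl (@letter m) x (w i)).
    by apply: ract_generator_basis => k; apply: xE; apply: mem_visited; apply: codom_f.
  (* Only words with the same endpoint as [w j] contribute to the coefficient there; those that also
     give the same power of t are congruent to [w j], so [c j] stands alone. *)
  pose c' i := if foldl (@letter m) x (w i) == foldl (@letter m) x (w j) then c i else 0.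
  have /tofrac_monomials/(_ j) : \sum_i scalars (c' i) * t ^+ count_mem ord_max (w i) = 0.
    have := congr1 (coeff (foldl (@letter m) x (w j))) (sum0 (basis F x)).
    rewrite coeff0 raddf_sum => coeff_sum0; rewrite -[RHS]coeff_sum0; apply: eq_bigr => i _.
    rewrite ractE ract_x [RHS](coeffZ (scalars (c i))) coeffZ coeff_basis /c'.
    by case: eqP => _; rewrite ?mulr1 ?mulr0 ?rmorph0 ?mul0r.
  rewrite (bigD1 j) //= /c' eqxx big1 ?addr0 // => i /andP[/eqP count_ij ij].
  case: eqP => // fold_ij; case/eqP: ij; apply: w_inj; exact: sep_x.
Qed.

End CountableField.

(** * Exchanging left and right modules *)

Section Opposite.
Variable n : nat.
Local Notation e := (ord_enum n).
Implicit Type w : seq 'I_n.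

(** Reversal alone would turn [e] around; renaming the letters in reverse order restores it, so an
    anti-automorphism of S_n results. *)
Definition opp_word w : seq 'I_n := map (@rev_ord n) (rev w).

Lemma opp_wordK : involutive opp_word.
Proof. by move=> w; rewrite /opp_word map_rev mapK ?revK //; apply: rev_ordK. Qed.

Lemma opp_word_cat w1 w2 : opp_word (w1 ++ w2) = opp_word w2 ++ opp_word w1.
Proof. by rewrite /opp_word rev_cat map_cat. Qed.

Lemma opp_word_cycle : opp_word e = e.
Proof.
apply: (inj_map val_inj); rewrite val_ord_enum; apply: (@eq_from_nth _ 0%N).
  by rewrite !size_map size_rev size_ord_enum size_iota.
move=> i; rewrite !size_map size_rev size_ord_enum => lt_in.
pose i' := Ordinal lt_in; have nth_e (j : 'I_n) : nth i' e j = j.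
  by rewrite (set_nth_default j) ?nth_ord_enum_self ?size_ord_enum.
rewrite nth_iota // -map_comp (nth_map i') ?size_rev ?size_ord_enum //.
rewrite nth_rev ?size_ord_enum // -[(n - i.+1)%N]/(val (rev_ord i')) nth_e /=.
by rewrite subnSK // subKn // ltnW.
Qed.

Lemma opp_word_rot k : exists l, opp_word (rot k e) = rot l e.
Proof.
exists (n - k)%N; rewrite /opp_word rev_rot map_rotr -/(opp_word e) opp_word_cycle.
by rewrite /rotr size_ord_enum.
Qed.

Lemma Scong_opp w1 w2 : Scong w1 w2 -> Scong (opp_word w1) (opp_word w2).
Proof.
elim=> [k u v|w|w w' _|w w' w'' _ IH1 _]; last exact: Scong_trans.
- rewrite !(opp_word_cat u) !(opp_word_cat _ v) opp_word_cycle; have [l ->] := opp_word_rot k.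
  by rewrite -(catA _ e) -(catA _ (rot l e)); apply: Scong_rel.
- exact: Scong_refl.
- exact: Scong_sym.
Qed.

Variables (K : fieldType) (V : lmodType K) (T : 'I_n -> {linear V -> V}).
Let T' i := T (rev_ord i).

Lemma ract_opp w v : ract T' w v = lact T (opp_word w) v.
Proof. by rewrite /lact /opp_word foldr_map -[w in LHS]revK /ract foldl_rev. Qed.

Lemma lact_opp w v : lact T' w v = ract T (opp_word w) v.
Proof. by rewrite /ract /opp_word map_rev foldl_rev foldr_map. Qed.

End Opposite.

Lemma rev_ord_simple n (K : fieldType) (V : lmodType K) (T : 'I_n -> {linear V -> V}) :
  simple_mod T -> simple_mod (fun i => T (rev_ord i)).
Proof.
case=> nzV simpleV; split=> // U [U0 UD UZ UT]; apply: simpleV; split=> // i x Ux.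
by rewrite -[i]rev_ordK; apply: UT.
Qed.

Section LeftRight.
Variables (n : nat) (K : fieldType) (V : lmodType K).
Variables act act' : seq 'I_n -> V -> V.
(** The two actions are kept abstract so that both [ract_opp] and [lact_opp] fit. *)
Hypothesis actE : forall w v, act' w v = act (opp_word w) v.

Lemma opp_Sn_rel : Sn_rel act -> Sn_rel act'.
Proof.
move=> relV k v; rewrite !actE opp_word_cycle.
by have [l ->] := opp_word_rot n k; apply: relV.
Qed.

Lemma opp_faithful : faithful_mod act -> faithful_mod act'.
Proof.
move=> faithV r w c w_inj sum0; apply: (faithV r (fun i => opp_word (w i))).
  by move=> i j /Scong_opp; rewrite !opp_wordK; apply: w_inj.
by move=> v; rewrite -[RHS](sum0 v); apply: eq_bigr => i _; rewrite actE.
Qed.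

End LeftRight.

Lemma left_right_primitive n (K : fieldType) :
  left_primitive_Sn K n <-> right_primitive_Sn K n.
Proof.
split=> -[V [T [relT simpleT faithT]]]; exists V, (fun i => T (rev_ord i)); split.
- exact: opp_Sn_rel (ract_opp T) relT.
- exact: rev_ord_simple.
- exact: opp_faithful (ract_opp T) faithT.
- exact: opp_Sn_rel (lact_opp T) relT.
- exact: rev_ord_simple.
- exact: opp_faithful (lact_opp T) faithT.
Qed.

Theorem theorem2p4 (n : nat) (hn : (3 <= n)%N) (K : fieldType) :
  (right_primitive_Sn K n <-> countable_type K) /\
  (left_primitive_Sn K n <-> countable_type K).
Proof.
suff right : right_primitive_Sn K n <-> countable_type K.
  by split=> //; apply: iff_trans right; apply: left_right_primitive.
case: n hn => [|[|[|m]]] // _; split; last exact: right_primitive_of_countable.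
by case=> V [T [relT simpleT faithT]]; apply: right_module_countable relT simpleT _ faithT.
Qed.
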